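(* Let $F$ be a distribution function on $\mathbb{R}$ with $\sup\{x:F(x)<1\}=\infty$ and $F\in MDA(\Lambda)$ with auxiliary function $f$, and write $\bar F=1-F$. Suppose $\lim_{x\to\infty}f(x)=\infty$ and that for some $L>0$, $$\lim_{x\to\infty}\frac{[\bar F(Lf(x))]^2}{\bar F(x)}=0.$$ Then for $X$ and $Y$ independent and identically distributed with common distribution $F$, as $x\to\infty$, $$P[X+Y>x]\sim 2P[X>x],$$ and therefore, if $F$ concentrates on $[0,\infty)$, then $F\in\mathcal{S}$.
   Context: $MDA(\Lambda)$ is the maximal domain of attraction of the Gumbel distribution $\Lambda(x)=\exp\{-e^{-x}\}$: the class of distribution functions $F$ for which there exist $a_n>0$, $b_n\in\mathbb{R}$ with $\lim_{n\to\infty}n\bar F(a_nx+b_n)=e^{-x}$ for all $x\in\mathbb{R}$. When $F$ has infinite right endpoint, $F\in MDA(\Lambda)$ is equivalent to the existence of an auxiliary function $f$: a positive function with derivative converging to $0$ at infinity, self-neglecting (i.e. $\lim_{t\to\infty}f(t+xf(t))/f(t)=1$ for all $x\in\mathbb{R}$), such that $\lim_{t\to\infty}\bar F(t+xf(t))/\bar F(t)=e^{-x}$ for all $x\in\mathbb{R}$. The function $f$ in the claim is such an auxiliary function of $F$. $\mathcal{S}$ denotes the class of subexponential distributions: distributions $F$ concentrated on $[0,\infty)$ with $\bar F(x)>0$ for all $x$ and $\lim_{x\to\infty}P(X+Y>x)/P(X>x)=2$ for $X,Y$ i.i.d. with distribution $F$. The notation $g(x)\sim h(x)$ means $g(x)/h(x)\to1$.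 *)

(* Defs.v *)
From HB Require Import structures.
From mathcomp Require Import all_boot all_order all_algebra.
From mathcomp Require Import all_classical all_reals all_analysis.

Set Implicit Arguments.
Unset Strict Implicit.
Unset Printing Implicit Defensive.

Import Order.TTheory GRing.Theory Num.Theory.
Import numFieldNormedType.Exports.

Local Open Scope classical_set_scope.
Local Open Scope ring_scope.

(* Distribution functions on the real line are the elements of
   [cumulativeBounded 0 1]: nondecreasing, right-continuous, with limits 0 at
   -oo and 1 at +oo; [lebesgue_stieltjes_measure F] is the law they define. *)

Definition survival (R : realType) (F : R -> R) (x : R) : R := 1 - F x.

Definition asymp_equiv (R : realType) (g h : R -> R) : Prop :=
  g x / h x @[x --> +oo] --> (1 : R).

Definition in_MDA_gumbel (R : realType)
    (F : cumulativeBounded (0 : R) (1 : R)) : Prop :=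
  exists a b : nat -> R, (forall n, 0 < a n) /\
    forall x : R,
      n%:R * survival F (a n * x + b n) @[n --> \oo] --> expR (- x).

(* An auxiliary function matters only near +oo and is often defined only there
   (such as x / ln x for the lognormal law), so that positivity and
   differentiability are required eventually; the values of [f] elsewhere are
   arbitrary. *)
Record auxiliary_function (R : realType)
    (F : cumulativeBounded (0 : R) (1 : R)) (f : R -> R) : Prop := {
  aux_gt0 : \forall t \near +oo, 0 < f t ;
  aux_derivable : \forall t \near +oo, derivable f t 1 ;
  aux_derive0 : derive1 f t @[t --> +oo] --> (0 : R) ;
  aux_self_neglecting : forall x : R,
    f (t + x * f t) / f t @[t --> +oo] --> (1 : R) ;
  aux_tail : forall x : R,
    survival F (t + x * f t) / survival F t @[t --> +oo] --> expR (- x)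
}.

Definition independent_RV d (T : measurableType d) (R : realType)
    (P : probability T R) (X Y : {RV P >-> R}) : Prop :=
  forall A B : set R, measurable A -> measurable B ->
    P (X @^-1` A `&` Y @^-1` B) = (P (X @^-1` A) * P (Y @^-1` B))%E.

Definition has_cdf d (T : measurableType d) (R : realType)
    (P : probability T R) (X : {RV P >-> R}) (F : R -> R) : Prop :=
  forall r : R, cdf X r = (F r)%:E.

Definition iid_pair d (T : measurableType d) (R : realType)
    (P : probability T R) (X Y : {RV P >-> R}) (F : R -> R) : Prop :=
  [/\ independent_RV X Y, has_cdf X F & has_cdf Y F].

Definition tail_prob d (T : measurableType d) (R : realType)
    (P : probability T R) (Z : T -> R) (x : R) : R :=
  fine (P [set w | x < Z w]).

Definition concentrated_nonneg (R : realType)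
    (F : cumulativeBounded (0 : R) (1 : R)) : Prop :=
  lebesgue_stieltjes_measure F `[0, +oo[ = 1%E.

Definition subexponential (R : realType)
    (F : cumulativeBounded (0 : R) (1 : R)) : Prop :=
  [/\ concentrated_nonneg F,
      forall x : R, 0 < survival F x &
      forall (d : measure_display) (T : measurableType d)
        (P : probability T R) (X Y : {RV P >-> R}),
        iid_pair X Y F ->
        tail_prob P (fun w => X w + Y w) x / tail_prob P X x
          @[x --> +oo] --> (2 : R)].

Lemma iid_pair_exists (R : realType)
    (F : cumulativeBounded (0 : R) (1 : R)) :
  exists (d : measure_display) (T : measurableType d) (P : probability T R)
    (X Y : {RV P >-> R}), iid_pair X Y F.
Proof.
pose TT : measurableType _ := (measurableTypeR R * measurableTypeR R)%type.
pose mu : probability (measurableTypeR R) R := lebesgue_stieltjes_measure F.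
pose P : probability (measurableTypeR R * measurableTypeR R)%type R :=
  [the probability _ _ of (mu \x mu)%E].
have mX : @measurable_fun _ _ (measurableTypeR R * measurableTypeR R)%type R
  setT fst by exact: measurable_fst.
have mY : @measurable_fun _ _ (measurableTypeR R * measurableTypeR R)%type R
  setT snd by exact: measurable_snd.
pose X : {RV P >-> R} := HB.pack_for {mfun _ >-> _} (fst : TT -> R)
  (@isMeasurableFun.Build _ _ TT R fst mX).
pose Y : {RV P >-> R} := HB.pack_for {mfun _ >-> _} (snd : TT -> R)
  (@isMeasurableFun.Build _ _ TT R snd mY).
have eX A : X @^-1` A = A `*` setT by apply/seteqP; split => -[x y] //= [].
have eY A : Y @^-1` A = setT `*` A by apply/seteqP; split => -[x y] //= [].
have PE (A B : set (measurableTypeR R)) : measurable A -> measurable B ->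
    P (A `*` B) = (mu A * mu B)%E by move=> mA mB; exact: product_measure1E.
have PX A : measurable A -> P (X @^-1` A) = mu A.
  move=> mA; rewrite eX.
  by have := PE _ _ mA measurableT; rewrite (probability_setT mu) mule1.
have PY A : measurable A -> P (Y @^-1` A) = mu A.
  move=> mA; rewrite eY.
  by have := PE _ _ measurableT mA; rewrite (probability_setT mu) mul1e.
have cmu (r : R) : mu (`]-oo, r]%classic : set R) = (F r)%:E.
  by rewrite -(cdf_lebesgue_stieltjes_id F r).
exists _, _, P, X, Y; split.
- move=> A B mA mB; rewrite PX// PY// eX eY -setXI setIT setTI.
  exact: PE.
- by move=> r; rewrite -cmu -PX.
- by move=> r; rewrite -cmu -PY.
Qed.

(* Main.v *)
(**
Split [X + Y > x] at the level [M = L f(x)] and at a fixed [K > 0].  If both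
variables exceed [M], the cost is at most [Fbar(M)^2 = o(Fbar(x))].  Otherwise
one of them, say [X], is at most [M]: if [X <= K] then [Y > x - K], and if
[K < X <= M] then [Y > x - M], with probability at most [Fbar(K) Fbar(x - M)],
which is asymptotic to [Fbar(K) e^L Fbar(x)].  Conversely the sum exceeds [x]
as soon as one variable exceeds [x + K] and the other one [-K].  Since [f]
tends to infinity, any bounded shift is eventually below [e f(x)], so that
[Fbar(x + a) ~ Fbar(x)] for every fixed [a]; let [K] tend to infinity.
*)
Require Import Defs.
From HB Require Import structures.
From mathcomp Require Import all_boot all_order all_algebra.
From mathcomp Require Import all_classical all_reals all_analysis.
From mathcomp Require Import measurable_realfun ring lra.

Import Order.TTheory GRing.Theory Num.Theory.
Import numFieldNormedType.Exports.

Local Open Scope classical_set_scope.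
Local Open Scope ring_scope.

(** Monotonicity squeezes the ratio between those at the shifts [c * f t] and [- c * f t], whose
    limits [expR (- c)] and [expR c] are close to 1 for small [c]. *)
Lemma cvg_ratio_shift (R : realType) (G f : R -> R) (a : R) :
  {homo G : x y / x <= y >-> y <= x} -> (forall x, 0 < G x) ->
  f x @[x --> +oo] --> +oo ->
  (forall c, G (t + c * f t) / G t @[t --> +oo] --> expR (- c)) ->
  G (t + a) / G t @[t --> +oo] --> (1 : R).
Proof.
move=> Gdec G0 fy Gf; apply/cvgrPdist_le => e e0.
have [c c0 [ec eNc]] : exists2 c : R, 0 < c &
    expR c < 1 + e /\ 1 - e < expR (- c).
  have exp1 : expR x @[x --> (0 : R)] --> (1 : R).
    by rewrite -[X in _ --> X]expR0; exact: continuous_expR.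
  have expN1 : expR (- x) @[x --> (0 : R)] --> (1 : R).
    have : {for (0 : R), continuous (fun x => expR (- x))}.
      apply: continuous_comp; first exact: oppr_continuous.
      exact: continuous_expR.
    by rewrite /prop_for /continuous_at oppr0 expR0.
  have /nbhs_ballP[d /= d0 hd] : \forall x \near (0 : R),
      expR x < 1 + e /\ 1 - e < expR (- x).
    near=> x; split; near: x.
    - by apply: cvgr_lt exp1 _ _; rewrite ltrDl.
    - by apply: cvgr_gt expN1 _ _; rewrite ltrBlDr ltrDl.
  (* The ball is open, so half its radius gives a point inside it. *)
  exists (d / 2); first by rewrite divr_gt0.
  by apply: hd; rewrite /ball/= sub0r normrN ger0_norm; lra.
near=> t.
have ta : `|a| <= c * f t.
  rewrite mulrC -ler_pdivrMr//; near: t.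
  by move/cvgryPge : fy; apply.
have up : G (t + - c * f t) / G t < 1 + e.
  by near: t; apply: cvgr_lt (Gf (- c)) _ _; rewrite opprK.
have dn : 1 - e < G (t + c * f t) / G t.
  by near: t; apply: cvgr_gt (Gf c) _ _.
have Gt := G0 t.
have u : G (t + a) / G t <= G (t + - c * f t) / G t.
  by rewrite ler_pM2r ?invr_gt0//; apply: Gdec; move: ta; rewrite ler_norml; lra.
have l : G (t + c * f t) / G t <= G (t + a) / G t.
  by rewrite ler_pM2r ?invr_gt0//; apply: Gdec; move: ta; rewrite ler_norml; lra.
by rewrite distrC ler_norml; lra.
Unshelve. all: end_near. Qed.

Section sum_tail.
Context d (T : measurableType d) (R : realType) (P : probability T R).
Implicit Types A B : set T.

(** Probabilities are handled as real numbers, via [fine], so that the tail estimates end in linear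
    arithmetic. *)
Lemma fine_prob_le A B : measurable A -> measurable B -> A `<=` B ->
  fine (P A) <= fine (P B).
Proof.
by move=> mA mB AB; rewrite fine_le ?fin_num_measure// le_measure ?inE.
Qed.

Lemma fine_probU_le A B : measurable A -> measurable B ->
  fine (P (A `|` B)) <= fine (P A) + fine (P B).
Proof.
move=> mA mB; rewrite -fineD ?fin_num_measure//.
by rewrite fine_le ?fin_numD ?fin_num_measure ?measureU2//; exact: measurableU.
Qed.

Lemma fine_probUI A B : measurable A -> measurable B ->
  fine (P (A `|` B)) = fine (P A) + fine (P B) - fine (P (A `&` B)).
Proof.
move=> mA mB; have mI := measurableI _ _ mA mB.
rewrite measureUfinr//; last by rewrite ltey_eq fin_num_measure.
by rewrite fineB ?fineD ?fin_numD ?fin_num_measure.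
Qed.

Variables (X Y : {RV P >-> R}) (F : R -> R).
Hypothesis XYF : iid_pair X Y F.
Let G := survival F.

Lemma gtr_preimage (Z : T -> R) (a : R) :
  [set w | a < Z w] = Z @^-1` `]a, +oo[.
Proof. by apply/seteqP; split => w /=; rewrite in_itv/= andbT. Qed.

Lemma measurable_gtr (Z : {RV P >-> R}) (a : R) : measurable [set w | a < Z w].
Proof.
by rewrite gtr_preimage -[X in measurable X]setTI; exact: measurable_funP.
Qed.

Lemma tail_prob_cdf (Z : {RV P >-> R}) (a : R) :
  has_cdf Z F -> tail_prob P Z a = G a.
Proof.
move=> ZF; rewrite /tail_prob gtr_preimage -[P _]/(ccdf Z a).
by rewrite ccdf_1_cdf ZF.
Qed.

(** This is where independence enters the tail bounds. *)
Lemma joint_tail (a b : R) :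
  fine (P ([set w | a < X w] `&` [set w | b < Y w])) = G a * G b.
Proof.
have [XY XF YF] := XYF.
rewrite -(tail_prob_cdf X a XF) -(tail_prob_cdf Y b YF) /tail_prob.
rewrite -fineM ?fin_num_measure//; [|exact: measurable_gtr..].
by rewrite !gtr_preimage XY.
Qed.

Lemma measurable_gtr_sum (x : R) : measurable [set w | x < X w + Y w].
Proof.
rewrite gtr_preimage -[X in measurable X]setTI.
by apply: measurable_funD => //; exact: measurable_funP.
Qed.

(** A union bound over five events: [A1] and [A2] serve when one variable is at most [K], [B1] and
    [B2] when it lies between [K] and [M], and [C] when both exceed [M]. *)
Lemma sum_tail_le (x K M : R) :
  tail_prob P (fun w => X w + Y w) x <=
  2 * G (x - K) + 2 * (G K * G (x - M)) + G M ^+ 2.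
Proof.
have [XY XF YF] := XYF.
have mX a := measurable_gtr X a; have mY a := measurable_gtr Y a.
pose A1 := [set w | x - K < X w]; pose A2 := [set w | x - K < Y w].
pose B1 := [set w | K < X w] `&` [set w | x - M < Y w].
pose B2 := [set w | x - M < X w] `&` [set w | K < Y w].
pose C := [set w | M < X w] `&` [set w | M < Y w].
have mB1 : measurable B1 by exact: measurableI.
have mB2 : measurable B2 by exact: measurableI.
have mC : measurable C by exact: measurableI.
have mA1 : measurable A1 by exact: mX.
have mA2 : measurable A2 by exact: mY.
have mA := measurableU _ _ mA1 mA2; have mB := measurableU _ _ mB1 mB2.
have mAB := measurableU _ _ mA mB.
have sub : [set w | x < X w + Y w] `<=` ((A1 `|` A2) `|` (B1 `|` B2)) `|` C.
  move=> w /= xw; rewrite /A1 /A2 /B1 /B2 /C/=.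
  have [XM|XM] := ltP M (X w); have [YM|YM] := ltP M (Y w); first by right.
  - have [YK|YK] := ltP K (Y w); left; [right; right; split|left; left] => //; lra.
  - have [XK|XK] := ltP K (X w); left; [right; left; split|left; right] => //; lra.
  - have [XK|XK] := ltP K (X w); left; [right; left; split|left; right] => //; lra.
have := fine_prob_le _ _ (measurable_gtr_sum x) (measurableU _ _ mAB mC) sub.
have := fine_probU_le _ _ mAB mC; have := fine_probU_le _ _ mA mB.
have := fine_probU_le _ _ mA1 mA2; have := fine_probU_le _ _ mB1 mB2.
have -> : fine (P A1) = G (x - K) by exact: (tail_prob_cdf X).
have -> : fine (P A2) = G (x - K) by exact: (tail_prob_cdf Y).
by rewrite !joint_tail /tail_prob; lra.
Qed.

(** Inclusion-exclusion for the events [A] and [B]: on their overlap both variables exceed [x + K],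
    which accounts for the subtracted square. *)
Lemma sum_tail_ge (x K : R) :
  2 * (G (x + K) * G (- K)) - G (x + K) ^+ 2 <=
  tail_prob P (fun w => X w + Y w) x.
Proof.
have mX a := measurable_gtr X a; have mY a := measurable_gtr Y a.
pose A := [set w | x + K < X w] `&` [set w | - K < Y w].
pose B := [set w | - K < X w] `&` [set w | x + K < Y w].
pose C := [set w | x + K < X w] `&` [set w | x + K < Y w].
have mA : measurable A by exact: measurableI.
have mB : measurable B by exact: measurableI.
have mC : measurable C by exact: measurableI.
have sub : A `|` B `<=` [set w | x < X w + Y w].
  by move=> w /= [] [] /=; lra.
have sub' : A `&` B `<=` C by move=> w [[? ?] [? ?]]; split.
have := fine_prob_le _ _ (measurableU _ _ mA mB) (measurable_gtr_sum x) sub.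
have := fine_prob_le _ _ (measurableI _ _ mA mB) mC sub'.
by rewrite fine_probUI// !joint_tail /tail_prob; lra.
Qed.

End sum_tail.

Arguments tail_prob_cdf {d T R P F Z}.
Arguments sum_tail_le {d T R P X Y F}.
Arguments sum_tail_ge {d T R P X Y F}.

Section tail_limits.
Context {R : realType} (F : cumulativeBounded (0 : R) (1 : R)).

Lemma survival_nonincreasing :
  {homo survival F : x y / x <= y >-> y <= x}.
Proof.
by move=> x y xy; rewrite lerD2l lerN2; exact: cumulative_is_nondecreasing.
Qed.

Lemma cvg_survivaly : survival F x @[x --> +oo] --> (0 : R).
Proof.
have : survival F x @[x --> +oo] --> (1 - 1 : R).
  by apply: cvgB; [exact: cvg_cst|exact: cumulativey].
by rewrite subrr.
Qed.

(** The limit at minus infinity is taken along [+oo], so that one large [K] can control both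
    [G (- K)] and [G K]. *)
Lemma cvg_survivalNy : survival F (- x) @[x --> +oo] --> (1 : R).
Proof.
have : survival F (- x) @[x --> +oo] --> (1 - 0 : R).
  apply: cvgB; first exact: cvg_cst.
  exact/(cvgNy_compNP F)/cumulativeNy.
by rewrite subr0.
Qed.

(** An infinite right endpoint provides a point beyond [x] where [F] is still below 1, and [F] is
    nondecreasing. *)
Lemma survival_gt0 :
  ereal_sup [set x%:E | x in [set x : R | F x < 1]] = +oo%E ->
  forall x, 0 < survival F x.
Proof.
move=> Fsup x; rewrite subr_gt0.
have := ltry x; rewrite -Fsup => /ereal_sup_gt[_ [y /= Fy <-]].
rewrite lte_fin => xy.
by apply: le_lt_trans Fy; apply: cumulative_is_nondecreasing; exact: ltW.
Qed.

End tail_limits.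

Lemma cvg_sum_tail_ratio (R : realType)
    (F : cumulativeBounded (0 : R) (1 : R)) (f : R -> R) (L : R)
    (d : measure_display) (T : measurableType d)
    (P : probability T R) (X Y : {RV P >-> R}) :
  (forall x, 0 < survival F x) ->
  auxiliary_function F f -> f x @[x --> +oo] --> +oo ->
  (survival F (L * f x)) ^+ 2 / survival F x @[x --> +oo] --> (0 : R) ->
  iid_pair X Y F ->
  tail_prob P (fun w => X w + Y w) x / survival F x @[x --> +oo] --> (2 : R).
Proof.
set G := survival F => G0 Ff fy FL XYF.
have Gf := aux_tail Ff.
have Gshift a := cvg_ratio_shift R G f a (survival_nonincreasing F) G0 fy Gf.
have Gy : G x @[x --> +oo] --> (0 : R) by exact: cvg_survivaly.
have GNy : G (- x) @[x --> +oo] --> (1 : R) by exact: cvg_survivalNy.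
apply/cvgrPdist_le => e e0.
(* [K] is fixed before [x]: as [x] grows, the normalised bounds tend to [2 * G (- K)] and
   [2 + 2 * (G K * expR L)], which must lie within [e] of 2. *)
have [K [GNK GK]] : exists K, 2 - e < 2 * G (- K) /\ 2 * (G K * expR L) < e.
  near (pinfty_nbhs R) => K; exists K; split.
  - rewrite mulrC -ltr_pdivrMr//; near: K.
    by apply: cvgr_gt GNy _ _; lra.
  - rewrite mulrA -ltr_pdivlMr ?expR_gt0// mulrC -ltr_pdivlMr//; near: K.
    by apply: cvgr_lt Gy _ _; rewrite !divr_gt0 ?expR_gt0.
(* The square divided by [G x] is split into a ratio tending to 1 and a factor tending to 0. *)
have lower : 2 * (G (x + K) / G x * G (- K)) - G (x + K) / G x * G (x + K)
    @[x --> +oo] --> 2 * (1 * G (- K)) - 1 * (0 : R).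
  apply: cvgB.
    by apply: cvgMr; apply: cvgMl; exact: Gshift.
  apply: cvgM; first exact: Gshift.
  by rewrite (cvg_shiftr K G).
(* With [M = L * f x], the point [x - M] is the auxiliary shift with parameter [- L], hence the
   factor [expR (- - L)]. *)
have upper : 2 * (G (x - K) / G x) + 2 * (G K * (G (x + - L * f x) / G x)) +
    G (L * f x) ^+ 2 / G x
    @[x --> +oo] --> 2 * 1 + 2 * (G K * expR (- - L)) + (0 : R).
  apply: cvgD; last exact: FL.
  apply: cvgD; first by apply: cvgMr; exact: Gshift.
  by apply: cvgMr; apply: cvgMr; exact: Gf.
near=> x.
have l : 2 - e <
    2 * (G (x + K) / G x * G (- K)) - G (x + K) / G x * G (x + K).
  by near: x; apply: cvgr_gt lower _ _; lra.
have u : 2 * (G (x - K) / G x) + 2 * (G K * (G (x + - L * f x) / G x)) +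
    G (L * f x) ^+ 2 / G x < 2 + e.
  by near: x; apply: cvgr_lt upper _ _; rewrite opprK; lra.
have Gx := G0 x.
have lower_x := sum_tail_ge XYF x K.
have upper_x := sum_tail_le XYF x K (L * f x).
rewrite -(ler_pM2r (x := (G x)^-1)) ?invr_gt0// in lower_x.
rewrite -(ler_pM2r (x := (G x)^-1)) ?invr_gt0// in upper_x.
move: lower_x upper_x l u; rewrite -/G mulNr distrC ler_norml.
(* Once the inverse of [G x] is an opaque [g], all the inequalities are linear in common
   monomials. *)
by move: (_^-1) => g; lra.
Unshelve. all: end_near. Qed.

Theorem corollary2p9 (R : realType)
    (F : cumulativeBounded (0 : R) (1 : R)) (f : R -> R)
    (Fsup : ereal_sup [set x%:E | x in [set x : R | F x < 1]] = +oo%E)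
    (FMDA : in_MDA_gumbel F)
    (Ff : auxiliary_function F f)
    (fy : f x @[x --> +oo] --> +oo)
    (FL : exists L : R, 0 < L /\
       (survival F (L * f x)) ^+ 2 / survival F x @[x --> +oo] --> (0 : R)) :
  (forall (d : measure_display) (T : measurableType d)
     (P : probability T R) (X Y : {RV P >-> R}),
     iid_pair X Y F ->
     asymp_equiv (tail_prob P (fun w => X w + Y w))
                 (fun x => 2 * tail_prob P X x)) /\
  (concentrated_nonneg F -> subexponential F).
Proof.
have G0 := survival_gt0 F Fsup.
have [L [_ FLL]] := FL.
have ratio d (T : measurableType d) (P : probability T R)
    (X Y : {RV P >-> R}) (XYF : iid_pair X Y F) :
    tail_prob P (fun w => X w + Y w) x / tail_prob P X x
      @[x --> +oo] --> (2 : R).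
  have [_ XF _] := XYF.
  under eq_cvg do rewrite (tail_prob_cdf _ XF).
  exact: cvg_sum_tail_ratio G0 Ff fy FLL XYF.
split=> [d T P X Y XYF|F0]; last by split=> // d T P X Y; exact: ratio.
(* The limit 1 is written [2 / 2], so that the constant factor [2^-1] can be split off the ratio. *)
rewrite /asymp_equiv -[X in _ --> X](@divff _ (2 : R)) ?pnatr_eq0//.
under eq_cvg do rewrite invfM mulrCA mulrC.
by apply: cvgMl; exact: ratio XYF.
Qed.
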